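(* Let $n, m \geq 1$ be integers and let $B \subseteq \mathbb{R}^{n+m}$ be an $n$-dimensional convex body with $d_{BM}(B, \Delta^n) \leq 2$. Let $v^1, \ldots, v^m \in \mathbb{R}^{n+m}$ be arbitrary vectors such that $C = \operatorname{conv}(B \cup \{v^1, \ldots, v^m\}) \subseteq \mathbb{R}^{n+m}$ is an $(n+m)$-dimensional convex body. Then \[ d_{BM}(C, \Delta^{n+m}) = d_{BM}(B, \Delta^n). \]
   Context: A convex body in $\mathbb{R}^N$ is a compact convex set with non-empty interior; a $d$-dimensional convex body in $\mathbb{R}^N$ is a compact convex set whose affine span has dimension $d$. For convex bodies $K, L \subseteq \mathbb{R}^N$ (with non-empty interior), their Banach--Mazur distance is \[ d_{BM}(K,L) = \inf\{\rho \geq 0 : K+u \subseteq T(L+v) \subseteq \rho(K+u)\}, \] the infimum over all invertible linear operators $T: \mathbb{R}^N \to \mathbb{R}^N$ and vectors $u, v \in \mathbb{R}^N$. For $d$-dimensional convex bodies $K, L$ the distance is defined in this way after identifying their affine spans with $\mathbb{R}^d$ by affine isomorphisms. $\Delta^n \subseteq \mathbb{R}^n$ denotes any (non-degenerate) simplex in $\mathbb{R}^n$, i.e. the convex hull of $n+1$ affinely independent points. $\operatorname{conv}$ denotes the convex hull. *)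

(* Defs.v *)
From HB Require Import structures.
From mathcomp Require Import all_boot all_order all_algebra.
From mathcomp Require Import boolp classical_sets reals ereal topology.
From mathcomp Require Import normedtype convex.

Set Implicit Arguments.
Unset Strict Implicit.
Unset Printing Implicit Defensive.

Import Order.TTheory GRing.Theory Num.Theory.
Import numFieldNormedType.Exports.

Local Open Scope classical_set_scope.
Local Open Scope ring_scope.

(* Vectors of R^N are row vectors, so the linear operator with matrix T acts  *)
(* by x |-> x *m T. The library topology on 'rV[R]_N is the one of the        *)
(* sup norm, i.e., the usual topology of R^N.                                 *)

Section Hulls.
Variables (R : realType) (E : lmodType R).

Definition convex_hull (A : set E) : set E :=
  [set x | exists (k : nat) (c : 'I_k -> R) (a : 'I_k -> E),
    [/\ forall i, 0 <= c i, \sum_i c i = 1, forall i, A (a i)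
      & x = \sum_i c i *: a i]].

Definition affine_hull (A : set E) : set E :=
  [set x | exists (k : nat) (c : 'I_k -> R) (a : 'I_k -> E),
    [/\ \sum_i c i = 1, forall i, A (a i) & x = \sum_i c i *: a i]].

Definition affinely_independent (k : nat) (p : 'I_k -> E) : Prop :=
  forall c : 'I_k -> R, \sum_i c i = 0 -> \sum_i c i *: p i = 0 ->
    forall i, c i = 0.

End Hulls.

Section ConvexBodies.
Variable R : realType.

Definition has_affine_dim (N d : nat) (S : set 'rV[R]_N) : Prop :=
  exists (V : {vspace 'rV[R]_N}) (b : 'rV[R]_N),
    \dim V = d /\ S = [set b + w | w in [set w | w \in V]].

Definition convex_body_dim (N d : nat) (K : set 'rV[R]_N) : Prop :=
  [/\ compact K, convex_set K & has_affine_dim d (affine_hull K)].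

Definition is_simplex (n : nat) (D : set 'rV[R]_n) : Prop :=
  exists2 p : 'I_n.+1 -> 'rV[R]_n,
    affinely_independent p & D = convex_hull (range p).

Definition bm_ratio (N : nat) (K L : set 'rV[R]_N) (rho : R) : Prop :=
  0 <= rho /\
  exists (T : 'M[R]_N) (u v : 'rV[R]_N),
    [/\ T \in unitmx,
        [set x + u | x in K] `<=` [set (y + v) *m T | y in L]
      & [set (y + v) *m T | y in L] `<=` [set rho *: (x + u) | x in K]].

(* The infimum is taken in the extended reals, so that no junk value arises   *)
(* for sets that are not convex bodies.                                       *)
Definition banach_mazur (N : nat) (K L : set 'rV[R]_N) : \bar R :=
  ereal_inf [set rho%:E | rho in bm_ratio K L].

Definition affine_iso (N d : nat) (f : 'rV[R]_d -> 'rV[R]_N)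
    (S : set 'rV[R]_N) : Prop :=
  exists (A : 'M[R]_(d, N)) (b : 'rV[R]_N),
    [/\ row_free A, f = (fun x => x *m A + b) & range f = S].

(* Any choice of the identifications f and g gives the same value             *)
(* (banach_mazur_dimE below), so the infimum over them is only a way of       *)
(* selecting that value.                                                      *)
Definition banach_mazur_dim (d N M : nat) (K : set 'rV[R]_N)
    (L : set 'rV[R]_M) : \bar R :=
  ereal_inf [set r | exists (f : 'rV[R]_d -> 'rV[R]_N)
                            (g : 'rV[R]_d -> 'rV[R]_M),
    [/\ affine_iso f (affine_hull K), affine_iso g (affine_hull L)
      & r = banach_mazur (f @^-1` K) (g @^-1` L)]].

Lemma affine_iso_change (N d : nat) (f f' : 'rV[R]_d -> 'rV[R]_N) S :
  affine_iso f S -> affine_iso f' S ->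
  exists2 P : 'M[R]_d, P \in unitmx &
    exists c : 'rV[R]_d, forall x, f' x = f (x *m P + c).
Proof.
move=> [A [b [Afree fE fS]]] [A' [b' [A'free f'E f'S]]].
have ff' x : exists y, y *m A + b = x *m A' + b'.
  have : range f (f' x) by rewrite fS -f'S; exists x.
  by move=> [y _]; rewrite fE f'E => yE; exists y.
have [c cE] := ff' 0; rewrite mul0mx add0r in cE.
have rowP i : {y : 'rV[R]_d | y *m A = row i A'}.
  apply: cid; have [y yE] := ff' (delta_mx 0 i); exists (y - c).
  apply: (@addIr _ (c *m A + b)).
  by rewrite addrA -mulmxDl subrK yE cE -rowE.
pose P := \matrix_i sval (rowP i).
have PA : P *m A = A'.
  by apply/row_matrixP => i; rewrite row_mul rowK (svalP (rowP i)).
exists P.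
  rewrite -row_free_unit /row_free eqn_leq rank_leq_row /=.
  by rewrite -[leqLHS](eqP A'free) -PA mxrankM_maxl.
by exists c => x; rewrite fE f'E mulmxDl -mulmxA PA -addrA cE.
Qed.

Lemma bm_ratio_affine (N : nat) (K L : set 'rV[R]_N) (P Q : 'M[R]_N)
    (c e : 'rV[R]_N) (rho : R) :
  P \in unitmx -> Q \in unitmx -> bm_ratio K L rho ->
  bm_ratio [set x | K (x *m P + c)] [set y | L (y *m Q + e)] rho.
Proof.
move=> Pu Qu [rho0 [T [u [v [Tu KL LK]]]]]; split=> //.
exists (Q *m T *m invmx P), ((u + c) *m invmx P), ((v + e) *m invmx Q).
have trL (y : 'rV[R]_N) :
    (y + (v + e) *m invmx Q) *m (Q *m T *m invmx P)
    = (y *m Q + e + v) *m T *m invmx P.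
  by rewrite !mulmxA [in LHS]mulmxDl mulmxKV // -addrA [e + v]addrC.
have trK (x : 'rV[R]_N) :
    x + (u + c) *m invmx P = (x *m P + c + u) *m invmx P.
  by rewrite -addrA [c + u]addrC [RHS]mulmxDl mulmxK.
split; first by rewrite !unitmx_mul unitmx_inv Pu Qu Tu.
- move=> _ [x /= Kx <-].
  have /KL [y Ly yE] : [set x + u | x in K] (x *m P + c + u).
    by exists (x *m P + c).
  exists ((y - e) *m invmx Q) => /=; first by rewrite mulmxKV // subrK.
  by rewrite trL mulmxKV // subrK yE trK.
- move=> _ [y /= Ly <-].
  have /LK [x Kx xE] : [set (y + v) *m T | y in L] ((y *m Q + e + v) *m T).
    by exists (y *m Q + e).
  exists ((x - c) *m invmx P) => /=; first by rewrite mulmxKV // subrK.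
  by rewrite trL -xE trK mulmxKV // subrK -scalemxAl.
Qed.

Lemma banach_mazur_iso_le (d N M : nat) (K S : set 'rV[R]_N)
    (L S' : set 'rV[R]_M) (f f' : 'rV[R]_d -> 'rV[R]_N)
    (g g' : 'rV[R]_d -> 'rV[R]_M) :
  affine_iso f S -> affine_iso f' S ->
  affine_iso g S' -> affine_iso g' S' ->
  (banach_mazur (f' @^-1` K) (g' @^-1` L)
   <= banach_mazur (f @^-1` K) (g @^-1` L))%E.
Proof.
move=> fS f'S gS' g'S'.
have [P Pu [c ff']] := affine_iso_change fS f'S.
have [Q Qu [e gg']] := affine_iso_change gS' g'S'.
apply: le_ereal_inf_tmp => _ [rho rhoP <-].
apply: ereal_inf_lbound; exists rho => //.
have -> : f' @^-1` K = [set x | (f @^-1` K) (x *m P + c)].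
  by apply/funext => x /=; rewrite /preimage /= ff'.
have -> : g' @^-1` L = [set x | (g @^-1` L) (x *m Q + e)].
  by apply/funext => x /=; rewrite /preimage /= gg'.
exact: bm_ratio_affine.
Qed.

Lemma banach_mazur_dimE (d N M : nat) (K : set 'rV[R]_N) (L : set 'rV[R]_M)
    (f : 'rV[R]_d -> 'rV[R]_N) (g : 'rV[R]_d -> 'rV[R]_M) :
  affine_iso f (affine_hull K) -> affine_iso g (affine_hull L) ->
  banach_mazur_dim d K L = banach_mazur (f @^-1` K) (g @^-1` L).
Proof.
move=> fK gL; apply/eqP; rewrite eq_le; apply/andP; split.
  by apply: ereal_inf_lbound; exists f, g.
apply: le_ereal_inf_tmp => _ [f' [g' [f'K g'L ->]]].
exact: (banach_mazur_iso_le K L f'K fK g'L gL).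
Qed.

Lemma banach_mazur_dim_full (N : nat) (K L : set 'rV[R]_N) :
  affine_hull K = setT -> affine_hull L = setT ->
  banach_mazur_dim N K L = banach_mazur K L.
Proof.
have idT : affine_iso (fun x : 'rV[R]_N => x) setT.
  exists 1%:M, 0; split; first by rewrite row_free_unit unitmx1.
    by apply/funext => x; rewrite mulmx1 addr0.
  by apply/seteqP; split=> // x _; exists x.
by move=> KT LT; rewrite (@banach_mazur_dimE _ _ _ K L id id) ?KT ?LT.
Qed.

Lemma affine_iso_exists (N d : nat) (S : set 'rV[R]_N) :
  has_affine_dim d S -> exists f : 'rV[R]_d -> 'rV[R]_N, affine_iso f S.
Proof.
move=> [V [b [dV ->]]]; rewrite -{d}dV.
pose A : 'M[R]_(\dim V, N) := \matrix_i (vbasis V)`_i.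
have AE (x : 'rV[R]_(\dim V)) :
    x *m A = \sum_i x 0 i *: (vbasis V)`_i.
  by rewrite mulmx_sum_row; apply: eq_bigr => i _; rewrite rowK.
exists (fun x => x *m A + b), A, b; split=> //.
- rewrite -kermx_eq0; apply/rowV0P => x /sub_kermxP; rewrite AE => x0.
  apply/rowP => i; rewrite mxE.
  by move/freeP: (basis_free (vbasisP V)) => /(_ (x 0)); apply.
- apply/seteqP; split=> [_ [x _ <-]|_ [w /= wV <-]].
    exists (x *m A); last by rewrite addrC.
    rewrite /= AE memv_suml // => i _.
    by rewrite memvZ // vbasis_mem // mem_nth // size_tuple.
  exists (\row_i coord (vbasis V) i w) => //.
  rewrite AE addrC; congr (_ + _); rewrite [RHS](coord_vbasis wV).
  by apply: eq_bigr => i _; rewrite mxE.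
Qed.

End ConvexBodies.

(* Main.v *)
Require Import Defs.
From HB Require Import structures.
From mathcomp Require Import all_boot all_order all_algebra.
From mathcomp Require Import boolp classical_sets reals ereal topology.
From mathcomp Require Import normedtype convex.
From mathcomp Require Import ring lra.

Set Implicit Arguments.
Unset Strict Implicit.
Unset Printing Implicit Defensive.

Import Order.TTheory GRing.Theory Num.Theory.
Import numFieldNormedType.Exports.

Local Open Scope classical_set_scope.
Local Open Scope ring_scope.

(** Let [K] have affine hull of dimension [d]. Then [rho] is an admissible
    ratio between [K] and a simplex iff [K] contains affinely independent
    points [p_0, ..., p_d] with respect to which the barycentric coordinates
    of [K] are bounded below by numbers [- a_i <= 0] with
    [\sum_i a_i <= rho - 1]: the set of points with such coordinates is a
    homothetic copy of ratio [1 + \sum_i a_i] of the simplex.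
    The body [C] is obtained from [B] by taking iterated pyramids, so it
    suffices to compare [K] with a pyramid [cone K v].

    From [K] to the pyramid, add the vertex [v] with bound [0]. Conversely, let
    [q_i = (1 - t_i) b_i + t_i v], with [b_i] in [K], be the vertices for the
    pyramid, with bounds [a_i], and let [l_i] be the coordinates of [v]. Choose
    [j] with [t_j] maximal. As [\sum_i a_i <= 1], one gets [1 <= l_j], and the
    points [b_i] with [i != j], which are the projections of the [q_i] from
    [v], work for [K]. If [x] in [K] has coordinates [c_i] with respect to [q],
    then its coordinates with respect to [b] are
    [(1 - t_i) (c_i - c_j l_i / l_j)]; the sum of their lower bounds is
    controlled by means of [\sum_i t_i c_i = 0] and [\sum_i t_i l_i = 1]. *)

(** * Affine independence and uniqueness of barycentric coordinates *)

Section AffineIndependence.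
Variables (R : realType) (E : lmodType R).

Lemma sum_delta k (i : 'I_k) : \sum_(h < k) (h == i)%:R = 1 :> R.
Proof. by rewrite (bigD1 i) //= eqxx big1 ?addr0 // => h /negPf ->. Qed.

Lemma sum_delta_scale k (i : 'I_k) (p : 'I_k -> E) :
  \sum_(h < k) (h == i)%:R *: p h = p i.
Proof.
rewrite (bigD1 i) //= eqxx scale1r big1 ?addr0 // => h /negPf ->.
by rewrite scale0r.
Qed.

Lemma affinely_independent_inj k (p : 'I_k -> E) (c c' : 'I_k -> R) :
  affinely_independent p -> \sum_i c i = \sum_i c' i ->
  \sum_i c i *: p i = \sum_i c' i *: p i -> c =1 c'.
Proof.
move=> pind cc' pp' i; apply/eqP; rewrite -subr_eq0; apply/eqP.
apply: (pind (fun i => c i - c' i)).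
  by rewrite sumrB cc' subrr.
by under eq_bigr do rewrite scalerBl; rewrite sumrB pp' subrr.
Qed.

Lemma affinely_independent_point_inj k (p : 'I_k -> E) i j :
  affinely_independent p -> p i = p j -> i = j.
Proof.
move=> pind pij; have [//|ij] := eqVneq i j.
have := @affinely_independent_inj _ p (fun h => (h == i)%:R)
  (fun h => (h == j)%:R) pind.
rewrite !sum_delta !sum_delta_scale => /(_ erefl pij i) /eqP.
by rewrite eqxx (negPf ij) oner_eq0.
Qed.

(** A combination may repeat points of the family, so its weights are added up over the fibres of a
    choice of indices. *)
Lemma convex_hull_range k (p : 'I_k -> E) x : convex_hull (range p) x ->
  exists c : 'I_k -> R,
    [/\ forall i, 0 <= c i, \sum_i c i = 1 & x = \sum_i c i *: p i].
Proof.
move=> [m [c [z [c0 c1 zp ->]]]].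
have /choice [f fP] h : exists i, p i = z h by have [i _ <-] := zp h; exists i.
exists (fun i => \sum_(h | f h == i) c h); split.
- by move=> i; rewrite sumr_ge0.
- by rewrite -c1 [RHS](partition_big f xpredT).
- rewrite (partition_big f xpredT) //=; apply: eq_bigr => i _.
  by rewrite scaler_suml; apply: eq_bigr => h /eqP <-; rewrite fP.
Qed.

End AffineIndependence.

(** * Simplex sandwiches and pyramids *)

Section Sandwich.
Variables (R : realType) (E : lmodType R).
Implicit Types (K : set E) (rho : R).

(** Only affine data enter, so the condition makes sense in any [E] and can be moved between [R^d]
    and an affine span. *)
Definition simplex_sandwich (d : nat) K rho : Prop :=
  exists (p : 'I_d.+1 -> E) (a : 'I_d.+1 -> R),
    [/\ affinely_independent p, forall i, K (p i), forall i, 0 <= a i,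
        \sum_i a i <= rho - 1
      & forall x, K x -> exists c : 'I_d.+1 -> R,
          [/\ \sum_i c i = 1, x = \sum_i c i *: p i & forall i, - a i <= c i]].

(** For nonempty convex [K] this is the convex hull of [K] and [v]; for empty [K] it is empty. *)
Definition cone K (v : E) : set E :=
  [set y | exists x t, [/\ K x, 0 <= t, t <= 1 & y = (1 - t) *: x + t *: v]].

(** The form [phi] puts [K] at height [e] and [v] at height [e + 1], so [v] lies off the affine span
    of [K]. The new coordinate of a pyramid point is its height [t] above [K]. *)
Lemma simplex_sandwich_cone d K rho v (phi : {scalar E}) (e : R) :
  (forall x, K x -> phi x = e) -> phi v = e + 1 ->
  simplex_sandwich d K rho -> simplex_sandwich d.+1 (cone K v) rho.
Proof.
move=> phiK phiv [p [a [pind pK a0 asum Kp]]].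
pose p' (i : 'I_d.+2) := oapp p v (unlift ord0 i).
pose a' (i : 'I_d.+2) := oapp a 0 (unlift ord0 i).
have p'0 : p' ord0 = v by rewrite /p' unlift_none.
have p'S i : p' (lift ord0 i) = p i by rewrite /p' liftK.
have a'0 : a' ord0 = 0 by rewrite /a' unlift_none.
have a'S i : a' (lift ord0 i) = a i by rewrite /a' liftK.
have sumE (c : 'I_d.+2 -> R) : \sum_i c i *: p' i =
    c ord0 *: v + \sum_i c (lift ord0 i) *: p i.
  by rewrite big_ord_recl p'0; under eq_bigr do rewrite p'S.
exists p', a'; split.
- move=> c c0; rewrite sumE => cp.
  have c00 : c ord0 = 0.
    move/(congr1 phi): cp; rewrite linearD linear_sum linear0 linearZ /= phiv.
    under eq_bigr => i _ do rewrite linearZ /= (phiK _ (pK i)).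
    rewrite -mulr_suml; move: c0; rewrite big_ord_recl => /eqP.
    by rewrite addrC addr_eq0 => /eqP ->; move=> h; lra.
  move: c0 cp; rewrite big_ord_recl c00 add0r scale0r add0r => c0 cp.
  move=> i; case: (unliftP ord0 i) => [j|] -> //.
  exact: (pind (fun i => c (lift ord0 i))).
- move=> i; case: (unliftP ord0 i) => [j|] ->; rewrite ?p'S ?p'0.
    exists (p j), 0; split=> //; rewrite ?ler01//.
    by rewrite subr0 scale1r scale0r addr0.
  by exists (p ord0), 1; split=> //; rewrite subrr scale1r scale0r add0r.
- by move=> i; case: (unliftP ord0 i) => [j|] ->; rewrite ?a'S ?a'0.
- by rewrite big_ord_recl a'0 add0r; under eq_bigr do rewrite a'S.
- move=> _ [x [t [/Kp [c [c1 -> ca]] t0 t1 ->]]].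
  exists (fun i => oapp (fun j => (1 - t) * c j) t (unlift ord0 i)).
  split.
  + rewrite big_ord_recl unlift_none /=.
    by under eq_bigr do rewrite liftK /=; rewrite -mulr_sumr c1; lra.
  + rewrite sumE unlift_none /= addrC; congr (_ + _).
    by rewrite scaler_sumr; apply: eq_bigr => i _; rewrite /= liftK scalerA.
  + move=> i; case: (unliftP ord0 i) => [j|] ->.
      rewrite /= a'S; have := ca j; have := a0 j; nra.
    by rewrite /= a'0 oppr0.
Qed.

(** * Scalar inequalities for the projection from the apex *)

Section ConeScalars.
Variables (d : nat) (a t l : 'I_d.+2 -> R) (j : 'I_d.+2).
Hypotheses (a0 : forall i, 0 <= a i) (asum : \sum_i a i <= 1).
Hypotheses (t0 : forall i, 0 <= t i) (t1 : forall i, t i <= 1).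
Hypotheses (l1 : \sum_i l i = 1) (tl1 : \sum_i t i * l i = 1).

(** In [\sum_k t k * l k = 1], each term with [k != j] is at most [(1 - t j) * a k]: by sign if
    [l k <= 0], by maximality of [t j] otherwise. As the [a k] sum to at most 1, this leaves
    [t j <= t j * l j]. *)
Lemma cone_apex_coordinate_ge1 :
  (forall i, t i <= t j) ->
  (forall k, k != j -> t j * l k <= (1 - t j) * a k) -> 0 < t j /\ 1 <= l j.
Proof.
move=> tj jP.
have tj0 : 0 < t j.
  rewrite lt_neqAle t0 andbT; apply/eqP => tj0.
  have: \sum_i t i * l i = 0.
    apply: big1 => i _; suff -> : t i = 0 by rewrite mul0r.
    by apply/eqP; rewrite eq_le t0 andbT tj0.
  by rewrite tl1 => /eqP; rewrite oner_eq0.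
split=> //.
have : 1 <= t j * l j + (1 - t j) * \sum_(i | i != j) a i.
  rewrite -[leLHS]tl1 (bigD1 j) //= lerD2l mulr_sumr; apply: ler_sum => k kj.
  have [lk|lk] := lerP (l k) 0.
    apply: le_trans (mulr_ge0_le0 (t0 k) lk) _. by rewrite mulr_ge0 ?subr_ge0.
  by apply: le_trans (jP _ kj); rewrite ler_pM2r.
move: asum; rewrite (bigD1 j) //=; have := a0 j; have := t1 j.
set s := \sum_(_ < _ | _) _ => h1 h2 h3 h4.
have : t j <= t j * l j by nra.
by rewrite ler_pMr.
Qed.

Let neg i := Num.max 0 (- l i).
Let M := (\sum_(i | i != j) t i * a i) / t j.

(* The two signs of [l i] are treated at once: [neg i] and [l i + neg i] are  *)
(* its negative and positive parts, and [M] bounds the [j]-th coordinate on   *)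
(* [K] from above.                                                            *)
Definition cone_slack i :=
  (1 - t i) * (a i + (a j * neg i + M * (l i + neg i)) / l j).

Hypotheses (tj0 : 0 < t j) (lj1 : 1 <= l j) (la : forall i, - a i <= l i).

Let neg0 i : 0 <= neg i. Proof. by rewrite le_max lexx. Qed.
Let negl i : 0 <= l i + neg i.
Proof. by rewrite -lerBlDl sub0r le_max lexx orbT. Qed.
Let nega i : neg i <= a i.
Proof. by rewrite ge_max a0 lerNl la. Qed.
Let M0 : 0 <= M.
Proof. by rewrite divr_ge0 ?t0 // sumr_ge0 // => i _; rewrite mulr_ge0. Qed.
Let lj0 : 0 < l j. Proof. exact: lt_le_trans lj1. Qed.

Lemma cone_slack_ge0 i : 0 <= cone_slack i.
Proof.
rewrite mulr_ge0 ?subr_ge0 // addr_ge0 // divr_ge0 ?(ltW lj0) //.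
by rewrite addr_ge0 // mulr_ge0.
Qed.

(** Let [N] be the sum of the [(1 - t i) * neg i] over [i != j]. The known sums of [l i] and
    [t i * l i] reduce the left side to [\sum_(i | i != j) a i - M + (a j + M) / l j * N], and
    [N <= \sum_i a i <= 1 <= l j] bounds the last term by [a j + M]. *)
Lemma cone_slack_sum : \sum_(i | i != j) cone_slack i <= \sum_i a i.
Proof.
have -> : \sum_(i | i != j) cone_slack i =
   \sum_(i | i != j) a i - \sum_(i | i != j) t i * a i
   + (a j + M) / l j * (\sum_(i | i != j) (1 - t i) * neg i)
   + M / l j * (\sum_(i | i != j) l i - \sum_(i | i != j) t i * l i).
  rewrite -!sumrB !mulr_sumr -!big_split /=; apply: eq_bigr => i _.
  by rewrite /cone_slack; ring.
have -> : \sum_(i | i != j) l i = 1 - l j.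
  by rewrite -l1 [in RHS](bigD1 j) //= addrAC subrr add0r.
have -> : \sum_(i | i != j) t i * l i = 1 - t j * l j.
  by rewrite -[in RHS]tl1 [in RHS](bigD1 j) //= addrAC subrr add0r.
have -> : \sum_(i | i != j) t i * a i = M * t j by rewrite divfK ?gt_eqF.
have N1 : \sum_(i | i != j) (1 - t i) * neg i <= l j.
  apply: le_trans lj1; apply: le_trans asum.
  rewrite [leRHS](bigD1 j) //= ler_wpDl //.
  apply: ler_sum => i _; have := nega i; have := neg0 i; have := t0 i; nra.
rewrite [leRHS](bigD1 j) //=.
set N := \sum_(_ < _ | _) (1 - _) * _ in N1 *.
have : (a j + M) / l j * N <= a j + M.
  by rewrite mulrAC ler_pdivrMr // ler_wpM2l // addr_ge0.
have -> : M / l j * (1 - l j - (1 - t j * l j)) = M * (t j - 1).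
  by field; rewrite gt_eqF.
lra.
Qed.

(** The relation [\sum_k t k * c k = 0] and the lower bounds give [c j <= M]. With [- a j <= c j],
    splitting [l i] by sign yields [c j * l i <= a j * neg i + M * (l i + neg i)]. *)
Lemma cone_slack_bound (c : 'I_d.+2 -> R) i :
  \sum_k t k * c k = 0 -> (forall k, - a k <= c k) ->
  - cone_slack i <= (1 - t i) * (c i - c j * l i / l j).
Proof.
move=> tc0 ca; rewrite /cone_slack -mulrN ler_wpM2l ?subr_ge0 //.
have cjM : c j <= M.
  rewrite ler_pdivlMr // -subr_ge0 [c j * _]mulrC.
  have -> : t j * c j = - \sum_(i | i != j) t i * c i.
    apply/eqP; rewrite -addr_eq0; apply/eqP.
    by rewrite -[RHS]tc0 [RHS](bigD1 j).
  rewrite opprK -big_split /= sumr_ge0 // => k _.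
  rewrite -mulrDr; apply: mulr_ge0 => //; have := ca k; lra.
rewrite opprD lerD //.
rewrite -mulNr -(mulNr (c j * l i)) ler_pM2r ?invr_gt0 //.
rewrite -subr_ge0.
have := ca j; have := neg0 i; have := negl i; move: cjM.
set x := neg i; set z := l i; move=> h1 h2 h3 h4; nra.
Qed.

End ConeScalars.

Lemma simplex_sandwich_cone_inv d K rho v (phi : {scalar E}) (e : R) :
  rho <= 2 -> (forall x, K x -> phi x = e) -> phi v = e + 1 ->
  simplex_sandwich d.+1 (cone K v) rho -> simplex_sandwich d K rho.
Proof.
move=> rho2 phiK phiv [q [a [qind qC a0 asum Cq]]].
have /choice [bt btP] i : exists bt : E * R,
  [/\ K bt.1, 0 <= bt.2, bt.2 <= 1 & q i = (1 - bt.2) *: bt.1 + bt.2 *: v].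
  by have [x [t [? ? ? ?]]] := qC i; exists (x, t).
pose b i := (bt i).1; pose t i := (bt i).2.
have Kb i : K (b i) by have [] := btP i.
have t0 i : 0 <= t i by have [] := btP i.
have t1 i : t i <= 1 by have [] := btP i.
have qE i : q i = (1 - t i) *: b i + t i *: v by have [] := btP i.
have CK x : K x -> cone K v x.
  by move=> Kx; exists x, 0; rewrite subr0 scale1r scale0r addr0 lexx ler01.
have [l [l1 vE la]] : exists l : 'I_d.+2 -> R,
    [/\ \sum_i l i = 1, v = \sum_i l i *: q i & forall i, - a i <= l i].
  apply: Cq; exists (b ord0), 1.
  by rewrite subrr scale1r scale0r add0r lexx ler01.
have phiq i : phi (q i) = e + t i.
  by rewrite qE linearD !linearZ /= phiK // phiv; ring.
have phisum (c : 'I_d.+2 -> R) :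
    phi (\sum_i c i *: q i) = e * (\sum_i c i) + \sum_i t i * c i.
  rewrite linear_sum mulr_sumr -big_split /=; apply: eq_bigr => i _.
  by rewrite linearZ /= phiq; ring.
have tl1 : \sum_i t i * l i = 1.
  move: phiv; rewrite {1}vE phisum l1 mulr1; exact: addrI.
(* With respect to [q], the coordinate of [q i = (1 - t i) b i + t i v] at [k != i] is 0, while that
   of [b i] is at least [- a k]. *)
have key i k : k != i -> t i * l k <= (1 - t i) * a k.
  move=> ki; have [mu [mu1 bE mua]] := Cq _ (CK _ (Kb i)).
  have := @affinely_independent_inj _ _ _ q
    (fun k => (1 - t i) * mu k + t i * l k)
    (fun k => (k == i)%:R) qind.
  rewrite -[X in _ -> X = _ -> _](_ : q i = _); last first.
    rewrite [LHS]qE [in LHS]bE [in LHS]vE !scaler_sumr -big_split /=.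
    by apply: eq_bigr => h _; rewrite !scalerA -scalerDl.
  rewrite big_split /= -!mulr_sumr mu1 l1 !mulr1 subrK.
  rewrite sum_delta sum_delta_scale.
  move=> /(_ erefl erefl k); rewrite (negPf ki) mulr0n.
  have := mua k; have := t1 i; nra.
pose j := [arg max_(j > (ord0 : 'I_d.+2)) t j]%O.
have tj i : t i <= t j.
  by rewrite /j; case: arg_maxP => // m _ /(_ i); apply.
(* This is where [rho <= 2] enters. *)
have a1 : \sum_i a i <= 1 by lra.
have [tj0 lj1] := cone_apex_coordinate_ge1 a0 a1 t0 t1 tl1 tj (key j).
have lj0 : l j != 0 by rewrite gt_eqF // (lt_le_trans _ lj1).
(* If this were 1, [key] would give [l j <= 0]. *)
have tlt i : t (lift j i) < 1.
  rewrite lt_neqAle t1 andbT; apply/eqP => ti.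
  by have := key _ _ (neq_lift j i); rewrite ti; lra.
have oneBt i : 1 - t (lift j i) != 0 by rewrite subr_eq0 gt_eqF.
have bE i : b (lift j i) =
    (1 - t (lift j i))^-1 *: (q (lift j i) - t (lift j i) *: v).
  by rewrite qE addrK scalerA mulVf // scale1r.
have lift_sum (V : nmodType) (F : 'I_d.+2 -> V) :
    \sum_i F i = F j + \sum_(i < d.+1) F (lift j i) by exact: bigD1_ord.
have lift_sum' (F : 'I_d.+2 -> R) :
    \sum_(i < d.+1) F (lift j i) = \sum_i F i - F j.
  by rewrite lift_sum addrAC subrr add0r.
exists (b \o lift j), (cone_slack a t l j \o lift j); split=> /=.
- move=> c c0 cb.
  (* A relation [c] between the projected points becomes a relation [g] between the [q h]: [- T] is
     the total coefficient of [v], which is expanded by [l]. The coefficient [- (T * l j)] at [j]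
     then forces [T = 0]. *)
  pose T := \sum_i t (lift j i) * (c i / (1 - t (lift j i))).
  pose g h := oapp (fun i => c i / (1 - t (lift j i))) 0 (unlift j h) - T * l h.
  have gj : g j = - (T * l j) by rewrite /g unlift_none /= sub0r.
  have gS i : g (lift j i) = c i / (1 - t (lift j i)) - T * l (lift j i).
    by rewrite /g liftK.
  have g0 : \sum_h g h = 0.
    rewrite lift_sum gj; under eq_bigr do rewrite gS.
    rewrite sumrB -mulr_sumr.
    have -> : \sum_i c i / (1 - t (lift j i)) = T.
      apply/eqP; rewrite -subr_eq0 -sumrB -[eqbRHS]c0; apply/eqP.
      by apply: eq_bigr => i _; rewrite -[X in X - _]mul1r -mulrBl mulrC divfK.
    have : \sum_i l (lift j i) = 1 - l j by rewrite lift_sum' l1.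
    by move=> ->; ring.
  have gq : \sum_h g h *: q h = 0.
    under eq_bigr do rewrite scalerBl -scalerA.
    rewrite sumrB -scaler_sumr -vE lift_sum unlift_none /= scale0r add0r.
    rewrite /T scaler_suml -sumrB -[RHS]cb; apply: eq_bigr => i _.
    by rewrite liftK /= bE scalerA scalerBr scalerA [in RHS](mulrC _ (t _)).
  have Tl : T = 0.
    have /eqP := qind _ g0 gq j.
    by rewrite gj oppr_eq0 mulf_eq0 (negPf lj0) orbF => /eqP.
  move=> i; have := qind _ g0 gq (lift j i); rewrite gS Tl mul0r subr0.
  by move/eqP; rewrite mulf_eq0 invr_eq0 (negPf (oneBt i)) orbF => /eqP.
- by move=> i; exact: Kb.
- by move=> i; apply: cone_slack_ge0.
- apply: le_trans asum.
  apply: le_trans (cone_slack_sum a0 a1 t0 l1 tl1 tj0 lj1 la).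
  by rewrite lift_sum' (bigD1 j) //= addrAC subrr add0r.
- move=> x Kx; have [lam [lam1 xE lama]] := Cq _ (CK _ Kx).
  have tlam : \sum_i t i * lam i = 0.
    have := phiK _ Kx; rewrite xE phisum lam1 mulr1 => /eqP.
    by rewrite -subr_eq0 addrAC subrr add0r => /eqP.
  (* Subtracting [lam j / l j] times the expansion of [v] eliminates [q j]. Each remaining [q i] is
     then replaced by [(1 - t i) b i + t i v], and the multiples of [v] cancel by [tlam] and
     [tl1]. *)
  exists (fun i => (1 - t (lift j i)) *
    (lam (lift j i) - lam j * l (lift j i) / l j)); split.
  + have -> : \sum_(i < d.+1) (1 - t (lift j i)) *
        (lam (lift j i) - lam j * l (lift j i) / l j) =
        \sum_(i < d.+1) lam (lift j i)
        - \sum_(i < d.+1) t (lift j i) * lam (lift j i)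
        - lam j / l j * (\sum_(i < d.+1) l (lift j i)
                         - \sum_(i < d.+1) t (lift j i) * l (lift j i)).
      by rewrite -!sumrB mulr_sumr -sumrB; apply: eq_bigr => i _; ring.
    rewrite (lift_sum' lam) (lift_sum' (fun i => t i * lam i)) (lift_sum' l).
    by rewrite (lift_sum' (fun i => t i * l i)) lam1 tlam l1 tl1; field.
  + transitivity (\sum_(i < d.+1) ((lam (lift j i) *: q (lift j i)
        - (lam j / l j) *: (l (lift j i) *: q (lift j i)))
        - (t (lift j i) * lam (lift j i)
           - lam j / l j * (t (lift j i) * l (lift j i))) *: v)); last first.
      apply: eq_bigr => i _.
      rewrite bE [(1 - _) * _]mulrC [RHS]scalerA mulfK // scalerBr !scalerA.
      by rewrite -scalerBl; congr (_ *: _ - _ *: _); ring.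
    rewrite !sumrB -scaler_sumr -scaler_suml sumrB -mulr_sumr.
    rewrite (lift_sum' (fun i => t i * lam i)) (lift_sum' (fun i => t i * l i)).
    rewrite tlam tl1.
    have -> : \sum_(i < d.+1) lam (lift j i) *: q (lift j i) = x - lam j *: q j.
      by rewrite xE lift_sum addrAC subrr add0r.
    have -> : \sum_(i < d.+1) l (lift j i) *: q (lift j i) = v - l j *: q j.
      by rewrite vE lift_sum addrAC subrr add0r.
    rewrite scalerBr scalerA divfK // opprB addrA subrK -addrA -opprD -scalerDl.
    rewrite [X in X *: v](_ : _ = 0) ?scale0r ?subr0 //.
    by field.
  + move=> i; exact: cone_slack_bound.
Qed.
End Sandwich.

(** * Convex combinations *)

Section ConvexCombinations.
Variables (R : realType) (E : lmodType R).
Implicit Types K : set E.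

Lemma convex_set_segment K x y (t : R) : convex_set K -> K x -> K y ->
  0 <= t -> t <= 1 -> K ((1 - t) *: x + t *: y).
Proof.
move=> Kconv Kx Ky t0 t1.
have ti : Itv.spec (@Itv.num_sem R) (Itv.Real `[0%Z, 1%Z]) t.
  by rewrite /= /Itv.num_sem /= in_itv /= num_real t0 t1.
have := Kconv y x (Itv.mk ti); rewrite !inE => /(_ Ky Kx).
by rewrite /conv /= addrC.
Qed.

Lemma sub_convex_hull K : K `<=` convex_hull K.
Proof.
move=> x Kx; exists 1%N, (fun=> 1), (fun=> x); split=> //.
  by rewrite big_ord1.
by rewrite big_ord1 scale1r.
Qed.

(** Induction on the number of points: the first is split off and the other weights are divided by
    their sum [1 - c ord0]. If this sum is 0, those weights all vanish. *)
Lemma convex_hull_sub (A K : set E) :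
  convex_set K -> A `<=` K -> convex_hull A `<=` K.
Proof.
move=> Kconv AK _ [k [c [a [c0 c1 aA ->]]]].
have {aA}aK i : K (a i) by exact: AK.
elim: k => [|k IHk] in c a c0 c1 aK *.
  by move: c1; rewrite big_ord0 => /eqP; rewrite eq_sym oner_eq0.
move: c1; rewrite !big_ord_recl => /eqP.
rewrite addrC eq_sym -subr_eq => /eqP/esym c1.
have s0 : 0 <= 1 - c ord0 by rewrite -c1 sumr_ge0.
have [s1|s1] := eqVneq (1 - c ord0) 0.
  rewrite s1 in c1; rewrite big1 ?addr0 => [|i _].
    by move/eqP: s1; rewrite subr_eq0 => /eqP <-; rewrite scale1r.
  have /eqP := c1; rewrite psumr_eq0 // => /allP /(_ i).
  by rewrite mem_index_enum => /(_ isT) /eqP ->; rewrite scale0r.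
have -> : \sum_(i < k) c (lift ord0 i) *: a (lift ord0 i) = (1 - c ord0) *:
    \sum_(i < k) (c (lift ord0 i) / (1 - c ord0)) *: a (lift ord0 i).
  by rewrite scaler_sumr; apply: eq_bigr => i _; rewrite scalerA mulrC divfK.
rewrite addrC; apply: convex_set_segment => //; last by rewrite -subr_ge0.
apply: IHk => // [i|]; first by rewrite divr_ge0.
by rewrite -mulr_suml c1 divff.
Qed.

End ConvexCombinations.

(** * Affine frames and barycentric coordinates *)

Section AffineFrames.
Variables (R : realType) (N : nat).
Implicit Types p : 'I_N.+1 -> 'rV[R]_N.

Definition edge_matrix p : 'M[R]_N := \matrix_i (p (lift ord0 i) - p ord0).

Lemma mul_edge_matrix p (x : 'rV[R]_N) :
  x *m edge_matrix p = \sum_i x 0 i *: (p (lift ord0 i) - p ord0).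
Proof. by rewrite mulmx_sum_row; apply: eq_bigr => i _; rewrite rowK. Qed.

Lemma edge_matrix_unit p : affinely_independent p -> edge_matrix p \in unitmx.
Proof.
move=> pind; rewrite -row_free_unit -kermx_eq0; apply/rowV0P => x.
move/sub_kermxP; rewrite mul_edge_matrix => x0.
pose c i := oapp (x 0) (- \sum_i x 0 i) (unlift ord0 i).
have c0 : c ord0 = - \sum_i x 0 i by rewrite /c unlift_none.
have cS i : c (lift ord0 i) = x 0 i by rewrite /c liftK.
apply/rowP => i; rewrite mxE -cS; apply: pind; rewrite big_ord_recl c0.
  by rewrite (eq_bigr _ (fun i _ => cS i)) addNr.
under [X in _ + X]eq_bigr do rewrite cS.
rewrite -[RHS]x0; under [in RHS]eq_bigr do rewrite scalerBr.
by rewrite sumrB -scaler_suml scaleNr addrC.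
Qed.

(** The coordinates of [y - p ord0] in the basis of edges at [p ord0] serve for the other vertices;
    the one at [ord0] makes the sum 1. *)
Lemma barycentric_exists p (y : 'rV[R]_N) : affinely_independent p ->
  exists c, \sum_i c i = 1 /\ y = \sum_i c i *: p i.
Proof.
move=> pind; pose x := (y - p ord0) *m invmx (edge_matrix p).
pose c i := oapp (x 0) (1 - \sum_i x 0 i) (unlift ord0 i).
have c0 : c ord0 = 1 - \sum_i x 0 i by rewrite /c unlift_none.
have cS i : c (lift ord0 i) = x 0 i by rewrite /c liftK.
exists c; rewrite !big_ord_recl c0; split.
  by rewrite (eq_bigr _ (fun i _ => cS i)) subrK.
under [X in _ + X]eq_bigr do rewrite cS.
rewrite scalerBl scale1r -addrA [- _ + _]addrC scaler_suml -sumrB.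
under eq_bigr do rewrite -scalerBr.
by rewrite -mul_edge_matrix mulmxKV ?edge_matrix_unit // addrC subrK.
Qed.

Lemma affine_map_frame p p' : affinely_independent p ->
  affinely_independent p' -> exists (T : 'M[R]_N) (w : 'rV[R]_N),
  T \in unitmx /\ forall i, p i *m T + w = p' i.
Proof.
move=> pind p'ind; pose T := invmx (edge_matrix p) *m edge_matrix p'.
have PT : edge_matrix p *m T = edge_matrix p'.
  by rewrite mulKVmx ?edge_matrix_unit.
exists T, (p' ord0 - p ord0 *m T); split.
  by rewrite unitmx_mul unitmx_inv !edge_matrix_unit.
move=> i; rewrite addrCA -mulmxBl; case: (unliftP ord0 i) => [k|] ->.
  rewrite -[X in X *m T](rowK (fun k => p (lift ord0 k) - p ord0)).
  by rewrite -row_mul PT rowK addrC subrK.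
by rewrite subrr mul0mx addr0.
Qed.

Lemma simplex_affine_hull (D : set 'rV[R]_N) :
  is_simplex D -> affine_hull D = setT.
Proof.
move=> [p pind ->]; apply/seteqP; split=> // y _.
have [c [c1 ->]] := barycentric_exists y pind; exists N.+1, c, p; split=> // i.
by apply: sub_convex_hull; exists i.
Qed.

(** The factor [r] serves the homothety of ratio [rho]; a rectangular [A] serves the identification
    of [R^d] with an affine span. *)
Lemma affinely_independent_map N' (A : 'M[R]_(N, N')) b (r : R) k
    (p : 'I_k -> 'rV[R]_N) : row_free A -> r != 0 ->
  affinely_independent p <->
  affinely_independent (fun i => r *: (p i *m A + b)).
Proof.
move=> Afree r0.
have sumE (c : 'I_k -> R) : \sum_i c i *: (r *: (p i *m A + b)) =
    r *: ((\sum_i c i *: p i) *m A + (\sum_i c i) *: b).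
  rewrite mulmx_suml scaler_suml -big_split scaler_sumr /=.
  by apply: eq_bigr => i _; rewrite -scalemxAl -scalerDr !scalerA mulrC.
split=> pind c c0 cp; apply: pind => //.
- apply: (row_free_inj Afree); apply: (scalerI r0).
  by rewrite mul0mx scaler0 -[RHS]cp sumE c0 scale0r addr0.
- by rewrite sumE cp c0 mul0mx scale0r addr0 scaler0.
Qed.

End AffineFrames.

(** * Ratios to a simplex as sandwiches *)

Section BanachMazurSandwich.
Variables (R : realType) (N : nat) (K D : set 'rV[R]_N).
Hypotheses (N_gt0 : (0 < N)%N) (Kconv : convex_set K) (Dsimplex : is_simplex D).

(** The vertices of the transformed simplex are [rho *: (y i + u)] with [y i] in [K]. If [x + u] is
    their convex combination with weights [c] and [- u] has coordinates [om], then [x] has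
    coordinates [rho * c i + (1 - rho) * om i], which are at least [- a i]. *)
Lemma bm_ratio_sandwich rho : bm_ratio K D rho -> simplex_sandwich N K rho.
Proof.
move=> [rho0 [T [u [w [Tu KD DK]]]]]; have [p pind DE] := Dsimplex.
have Tfree : row_free T by rewrite row_free_unit.
have /choice [y yP] i : exists y, K y /\ rho *: (y + u) = (p i + w) *m T.
  have [|y Ky yE] := DK ((p i + w) *m T); last by exists y.
  by exists (p i) => //; rewrite DE; apply: sub_convex_hull; exists i.
(* For [rho = 0] all vertices of the simplex would coincide, but there are at least two. *)
have rhoE : rho != 0.
  apply/eqP => r0; have : (ord0 : 'I_N.+1) = ord_max.
    apply: (affinely_independent_point_inj pind); apply: (addIr w).
    apply: (row_free_inj Tfree).
    by rewrite -(yP ord0).2 -(yP ord_max).2 r0 !scale0r.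
  by move/(congr1 val) => /= N0; move: N_gt0; rewrite -N0.
have yind : affinely_independent y.
  apply/(affinely_independent_map u _ (A := 1%:M) _ rhoE).
    by rewrite row_free_unit unitmx1.
  move: pind; rewrite (affinely_independent_map (w *m T) _ Tfree (oner_neq0 R)).
  congr affinely_independent; apply/funext => i.
  by rewrite mulmx1 (yP i).2 scale1r mulmxDl.
have [om [om1 uE]] := barycentric_exists (- u) yind.
pose a i := (rho - 1) * om i.
have Kcov x : K x -> exists c : 'I_N.+1 -> R,
    [/\ \sum_i c i = 1, x = \sum_i c i *: y i & forall i, - a i <= c i].
  move=> Kx; have [|z Dz zE] := KD (x + u); first by exists x.
  move: Dz; rewrite DE => /convex_hull_range [c [c0 c1 zc]].
  have xE : x + u = rho *: (\sum_i c i *: y i + u).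
    rewrite -zE zc; transitivity (\sum_i c i *: ((p i + w) *m T)).
      rewrite -[w in LHS]scale1r -c1 scaler_suml -big_split /= mulmx_suml.
      by apply: eq_bigr => i _; rewrite -scalerDr scalemxAl.
    rewrite -[u in RHS]scale1r -c1 scaler_suml -big_split scaler_sumr /=.
    apply: eq_bigr => i _.
    by rewrite -(yP i).2 -scalerDr !scalerA mulrC.
  exists (fun i => rho * c i + (1 - rho) * om i); split.
  - by rewrite big_split /= -!mulr_sumr c1 om1 !mulr1 addrC subrK.
  - apply: (addIr u); rewrite xE.
    have -> : \sum_i (rho * c i + (1 - rho) * om i) *: y i =
        rho *: (\sum_i c i *: y i) + (1 - rho) *: - u.
      rewrite uE !scaler_sumr -big_split; apply: eq_bigr => i _.
      by rewrite scalerDl !scalerA.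
    rewrite scalerDr -addrA; congr (_ + _).
    by rewrite scalerN scalerBl scale1r opprB subrK.
  - by move=> i; rewrite /a -mulNr opprB lerDr mulr_ge0.
exists y, a; split=> //.
- by move=> i; have [] := yP i.
(* Another vertex [y k] lies in [K] and has coordinate 0 at [i], so the lower bound [- a i] is at
   most 0. *)
- move=> i; pose k := if i == ord0 then ord_max else ord0 : 'I_N.+1.
  have ki : k != i.
    rewrite /k; have [->|//] := eqVneq i ord0; last by rewrite eq_sym.
    by rewrite -val_eqE /= -lt0n.
  have [c [c1 yE ca]] := Kcov _ (yP k).1.
  have := affinely_independent_inj yind (c := c) (c' := fun h => (h == k)%:R).
  rewrite sum_delta sum_delta_scale => /(_ c1 (esym yE) i).
  rewrite eq_sym (negPf ki) => ci0.
  by have := ca i; rewrite ci0 oppr_le0.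
- by rewrite -mulr_sumr om1 mulr1.
Qed.

Lemma sandwich_bm_ratio rho : simplex_sandwich N K rho -> bm_ratio K D rho.
Proof.
move=> [y [a0 [yind Ky a00 a0sum Kcov0]]]; have [p pind DE] := Dsimplex.
(* The slack below [rho - 1] is added to the bound at [ord0], so that the sum is exact. *)
have [a [a_ge0 asum Kcov]] : exists a : 'I_N.+1 -> R,
  [/\ forall i, 0 <= a i, \sum_i a i = rho - 1
    & forall x, K x -> exists c : 'I_N.+1 -> R,
      [/\ \sum_i c i = 1, x = \sum_i c i *: y i & forall i, - a i <= c i]].
  have s0 : 0 <= rho - 1 - \sum_i a0 i by rewrite subr_ge0.
  exists (fun i => a0 i + (i == ord0)%:R * (rho - 1 - \sum_i a0 i)); split.
  - by move=> i; rewrite addr_ge0 // mulr_ge0.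
  - by rewrite big_split /= -mulr_suml sum_delta mul1r addrC subrK.
  - move=> x /Kcov0 [c [c1 xE ca]]; exists c; split=> // i.
    by apply: le_trans (ca i); rewrite lerN2 lerDl mulr_ge0.
have rho1 : 1 <= rho by rewrite -subr_ge0 -asum sumr_ge0.
have rho0 : rho != 0 by rewrite gt_eqF // (lt_le_trans ltr01).
have rho_ge0 : 0 <= rho := le_trans ler01 rho1.
(* The point [- u] is the centre of the homothety. For [rho = 1] the inverse of 0 is 0, so [u = 0];
   then all [a i] vanish and [uE] still holds. *)
pose u := - (rho - 1)^-1 *: \sum_i a i *: y i.
have uE : (rho - 1) *: u = - \sum_i a i *: y i.
  have [r1|r1] := eqVneq (rho - 1) 0.
    rewrite r1 scale0r big1 ?oppr0 // => i _.
    move: asum; rewrite r1 => /eqP; rewrite psumr_eq0 // => /allP /(_ i).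
    by rewrite mem_index_enum => /(_ isT) /eqP ->; rewrite scale0r.
  by rewrite /u scalerA mulrN divff // scaleN1r.
have ryind : affinely_independent (fun i => rho *: (y i *m 1%:M + 0)).
  apply/(affinely_independent_map 0 y (A := 1%:M) _ rho0) => //.
  by rewrite row_free_unit unitmx1.
have [T [w [Tu pT]]] := affine_map_frame pind ryind.
have {}pT i : p i *m T + w = rho *: y i by rewrite pT mulmx1 addr0.
have TD (c : 'I_N.+1 -> R) : \sum_i c i = 1 ->
    (\sum_i c i *: p i + (w + rho *: u) *m invmx T) *m T =
    rho *: (\sum_i c i *: y i + u).
  move=> c1; rewrite mulmxDl mulmxKV // scalerDr addrA; congr (_ + _).
  rewrite mulmx_suml -[X in _ + X]scale1r -c1 scaler_suml -big_split.
  rewrite scaler_sumr /=; apply: eq_bigr => i _.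
  by rewrite -scalemxAl -scalerDr pT !scalerA mulrC.
split=> //.
exists T, u, ((w + rho *: u) *m invmx T); split=> //.
- move=> _ [x /Kcov [c [c1 xE ca]] <-].
  (* Adding [a i] makes the coordinates nonnegative with sum [rho]. *)
  exists (\sum_i ((c i + a i) / rho) *: p i).
    rewrite DE; exists N.+1, (fun i => (c i + a i) / rho), p; split=> // [i|].
    + by rewrite divr_ge0 ?rho_ge0 // -lerBlDr sub0r.
    + by rewrite -mulr_suml big_split /= c1 asum addrC subrK divff.
  rewrite TD; last first.
    by rewrite -mulr_suml big_split /= c1 asum addrC subrK divff.
  rewrite scalerDr scaler_sumr.
  under eq_bigr do rewrite scalerA mulrC divfK // scalerDl.
  rewrite big_split /= -xE -[\sum_i _]opprK -uE scalerBl scale1r opprB.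
  by rewrite -addrA subrK.
- move=> _ [z Dz <-]; move: Dz; rewrite DE.
  move=> /convex_hull_range [c [c0 c1 ->]].
  exists (\sum_i c i *: y i); last by rewrite -TD.
  by apply: (convex_hull_sub Kconv (A := K)) => //; exists N.+1, c, y.
Qed.

End BanachMazurSandwich.

(** * Iterated pyramids *)

Section ConeTower.
Variables (R : realType) (E : lmodType R).
Implicit Types (K B : set E) (v : nat -> E).

Lemma segment_convex_set K :
  (forall x y (t : R), K x -> K y -> 0 <= t -> t <= 1 ->
    K ((1 - t) *: x + t *: y)) -> convex_set K.
Proof.
move=> Kseg x y t; rewrite !inE => Kx Ky; rewrite /conv /= addrC.
exact: Kseg.
Qed.

Lemma cone_convex K w : convex_set K -> convex_set (cone K w).
Proof.
move=> Kconv; apply: segment_convex_set.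
move=> _ _ s [x [t [Kx t0 t1 ->]]] [x' [t' [Kx' t'0 t'1 ->]]] s0 s1.
pose al := (1 - s) * (1 - t); pose be := s * (1 - t').
have al0 : 0 <= al by rewrite mulr_ge0 ?subr_ge0.
have be0 : 0 <= be by rewrite mulr_ge0 ?subr_ge0.
pose T := (1 - s) * t + s * t'.
have TE : 1 - T = al + be by rewrite /T /al /be; ring.
have T0 : 0 <= T by rewrite addr_ge0 // mulr_ge0 ?subr_ge0.
have T1 : T <= 1 by rewrite -subr_ge0 TE addr_ge0.
have -> : (1 - s) *: ((1 - t) *: x + t *: w)
    + s *: ((1 - t') *: x' + t' *: w) = (al *: x + be *: x') + T *: w.
  by rewrite !scalerDr !scalerA addrACA -scalerDl.
(* If [al + be = 0] the combination is the apex, and any base point will do; otherwise the base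
   weights are normalised. *)
have [ab0|ab0] := eqVneq (al + be) 0.
  have [a0 b0] : al = 0 /\ be = 0.
    by move/eqP: ab0; rewrite paddr_eq0 // => /andP[/eqP -> /eqP ->].
  exists x, T; split=> //.
  by rewrite TE a0 b0 addr0 !scale0r !add0r.
exists ((1 - be / (al + be)) *: x + (be / (al + be)) *: x'), T; split=> //.
  apply: convex_set_segment => //; first by rewrite divr_ge0 ?addr_ge0.
  by rewrite ler_pdivrMr ?mul1r ?lerDr // lt_neqAle eq_sym ab0 addr_ge0.
rewrite TE scalerDr !scalerA; congr (_ *: _ + _ *: _ + _); by field.
Qed.

Lemma sub_cone K w : K `<=` cone K w.
Proof.
move=> x Kx; exists x, 0; split=> //.
by rewrite subr0 scale1r scale0r addr0.
Qed.

Lemma cone_apex K w x : K x -> cone K w w.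
Proof.
move=> Kx; exists x, 1; split=> //.
by rewrite subrr scale0r scale1r add0r.
Qed.

(** Indexing the apexes by [nat] lets every stage use the same family without casts. *)
Fixpoint cone_tower B v k : set E :=
  if k is k'.+1 then cone (cone_tower B v k') (v k') else B.

Lemma cone_tower_convex B v k : convex_set B -> convex_set (cone_tower B v k).
Proof. by move=> Bconv; elim: k => //= k; apply: cone_convex. Qed.

Lemma sub_cone_tower B v k : B `<=` cone_tower B v k.
Proof. by elim: k => //= k IHk x /IHk; apply: sub_cone. Qed.

Lemma cone_tower_apex B v k i x : B x -> (i < k)%N -> cone_tower B v k (v i).
Proof.
move=> Bx; elim: k => //= k IHk; rewrite ltnS leq_eqVlt => /predU1P[->|ik].
  by apply: cone_apex; apply: sub_cone_tower Bx.
by apply: sub_cone; apply: IHk.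
Qed.

Lemma cone_tower_sub B v k (C : set E) : convex_set C -> B `<=` C ->
  (forall i, (i < k)%N -> C (v i)) -> cone_tower B v k `<=` C.
Proof.
move=> Cconv BC; elim: k => //= k IHk vC _ [x [t [Kx t0 t1 ->]]].
apply: convex_set_segment => //; last exact: vC.
by apply: IHk => // i ik; apply: vC; apply: ltnW.
Qed.

(** Each side is a convex set containing [B] and the apexes, and is contained in every other such
    set. A point of [B] is what puts the apexes into the tower. *)
Lemma cone_tower_hull B v k : convex_set B -> B !=set0 ->
  convex_set (convex_hull (B `|` [set v i | i in [set i | (i < k)%N]])) ->
  cone_tower B v k = convex_hull (B `|` [set v i | i in [set i | (i < k)%N]]).
Proof.
move=> Bconv [x Bx] Cconv; apply/seteqP; split.
  apply: cone_tower_sub => // [y By|i ik]; apply: sub_convex_hull.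
    by left.
  by right; exists i.
apply: convex_hull_sub; first exact: cone_tower_convex.
move=> y [|[i ik <-]]; first exact: sub_cone_tower.
exact: cone_tower_apex Bx ik.
Qed.

Section Sandwich.
Variables (B : set E) (v : nat -> E) (d m : nat).
Variables (phi : nat -> {scalar E}) (e : nat -> R).
Hypothesis phiB : forall j x, (j < m)%N -> B x -> phi j x = e j.
Hypothesis phiv : forall i j, (i < m)%N -> (j < m)%N ->
  phi j (v i) = e j + (i == j)%:R.

(** Stage [k] only involves apexes [v i] with [i < k <= j], and there [phi j] has the same value
    [e j] as on [B]. *)
Lemma cone_tower_form k j x : (k <= j)%N -> (j < m)%N ->
  cone_tower B v k x -> phi j x = e j.
Proof.
move=> kj jm; elim: k => [|k IHk] /= in x kj *; first exact: phiB.
move=> [y [t [Ky t0 t1 ->]]].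
rewrite linearD !linearZ /= IHk ?(ltnW kj) // phiv ?(ltn_trans kj) //.
by rewrite ltn_eqF // addr0 -mulrDl subrK mul1r.
Qed.

Lemma simplex_sandwich_tower rho k : (k <= m)%N ->
  simplex_sandwich d B rho -> simplex_sandwich (d + k) (cone_tower B v k) rho.
Proof.
elim: k => [|k IHk] km Bs; first by rewrite addn0.
rewrite addnS; apply: (simplex_sandwich_cone (phi := phi k) (e := e k)).
- by move=> x; apply: cone_tower_form.
- by rewrite phiv // eqxx.
- by apply: IHk => //; apply: ltnW.
Qed.

Lemma simplex_sandwich_tower_inv rho k : (k <= m)%N -> rho <= 2 ->
  simplex_sandwich (d + k) (cone_tower B v k) rho -> simplex_sandwich d B rho.
Proof.
move=> + rho2; elim: k => [|k IHk] km; first by rewrite addn0.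
rewrite addnS => Cs; apply: IHk; first exact: ltnW.
apply: (simplex_sandwich_cone_inv (phi := phi k) (e := e k) rho2 _ _ Cs).
- by move=> x; apply: cone_tower_form.
- by rewrite phiv // eqxx.
Qed.

End Sandwich.
End ConeTower.

(** * Transport along affine isomorphisms *)

Section AffineIso.
Variables (R : realType) (N d : nat) (f : 'rV[R]_d -> 'rV[R]_N).
Variables (S K : set 'rV[R]_N).
Hypotheses (fS : affine_iso f S) (KS : K `<=` S).

Lemma affine_iso_sum k (c : 'I_k -> R) p : \sum_i c i = 1 ->
  f (\sum_i c i *: p i) = \sum_i c i *: f (p i).
Proof.
have [A [b [_ -> _]]] := fS => c1; rewrite -[b in LHS]scale1r -c1 scaler_suml.
rewrite mulmx_suml -big_split; apply: eq_bigr => i _.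
by rewrite scalerDr scalemxAl.
Qed.

Lemma affine_iso_convex : convex_set K -> convex_set (f @^-1` K).
Proof.
move=> Kconv; apply: segment_convex_set => x y t Kx Ky t0 t1.
have [A [b [_ fE _]]] := fS.
rewrite /preimage /= [f _](_ : _ = (1 - t) *: f x + t *: f y).
  exact: convex_set_segment.
rewrite !fE !scalerDr addrACA -scalerDl subrK scale1r mulmxDl.
by rewrite !scalemxAl.
Qed.

(** An injective affine [f] preserves affine independence and barycentric coordinates, and all
    points of [K] have preimages since [K] lies in the range of [f]. *)
Lemma simplex_sandwich_affine_iso k rho :
  simplex_sandwich k (f @^-1` K) rho <-> simplex_sandwich k K rho.
Proof.
have [A [b [Afree fE fS']]] := fS.
have finj : injective f.
  by move=> x y; rewrite fE => /addIr; apply: row_free_inj.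
have find h (p : 'I_h -> _) :
    affinely_independent p <-> affinely_independent (f \o p).
  rewrite (affinely_independent_map b p Afree (oner_neq0 R)) fE.
  by under [X in _ <-> _ X]eq_fun do rewrite -[_ + _]scale1r.
split=> -[p [a [pind pK a0 asum Kp]]].
- exists (f \o p), a; split=> //; first exact/find.
  move=> x Kx; have [z _ zx] : range f x by rewrite fS'; apply: KS.
  have [|c [c1 zE ca]] := Kp z; first by rewrite /preimage /= zx.
  by exists c; split=> //; rewrite -zx zE affine_iso_sum.
- have /choice [q qp] i : exists z, f z = p i.
    by have [z _ <-] : range f (p i) by [rewrite fS'; apply: KS]; exists z.
  have pE : p = f \o q by apply/funext => i; rewrite /= qp.
  exists q, a; split=> //; first by apply/find; rewrite -pE.
    by move=> i; rewrite /preimage /= qp.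
  move=> x /Kp [c [c1 xE ca]]; exists c; split=> //.
  by apply: finj; rewrite xE affine_iso_sum // pE.
Qed.

End AffineIso.

(** * Linear forms separating the apexes *)

Section Coordinates.
Variables (R : realType) (N : nat) (Q : 'M[R]_N) (k : 'I_N).

Definition coordinate_form (y : 'rV[R]_N) : R := (y *m Q) 0 k.

Fact coordinate_form_scalar : scalar coordinate_form.
Proof. by move=> c x y; rewrite /coordinate_form mulmxDl -scalemxAl !mxE. Qed.

HB.instance Definition _ := GRing.isLinear.Build R 'rV[R]_N R *%R
  coordinate_form coordinate_form_scalar.

End Coordinates.

Lemma affine_dim_full (R : realType) N (S : set 'rV[R]_N) :
  has_affine_dim N S -> S = setT.
Proof.
move=> [V [b [dimV ->]]]; apply/seteqP; split=> // x _.
exists (x - b); last by rewrite addrC subrK.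
have -> : V = fullv by apply/eqP; rewrite eqEdim subvf dimV dimvf /dim /= mul1n.
exact: memvf.
Qed.

(** The directions of the span of [B], stacked with the vectors [v j - b], form a square matrix [M]
    whose rows span because [C] has full dimension. The forms are the last [m] coordinates in this
    basis. *)
Lemma apex_forms (R : realType) (n m : nat) (B : set 'rV[R]_(n + m))
    (v : 'I_m -> 'rV[R]_(n + m))
    (f : 'rV[R]_n -> 'rV[R]_(n + m)) :
  affine_iso f (affine_hull B) ->
  affine_hull (convex_hull (B `|` range v)) = setT ->
  exists (phi : 'I_m -> {scalar 'rV[R]_(n + m)}) (e : 'I_m -> R),
    (forall j x, B x -> phi j x = e j) /\
    (forall i j, phi j (v i) = e j + (i == j)%:R).
Proof.
move=> [A [b [Afree fE fB]]] CT.
pose W := \matrix_j (v j - b); pose M := col_mx A W.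
have BA x : B x -> exists z, x = z *m A + b.
  move=> Bx; suff [z _ <-] : range f x by exists z; rewrite fE.
  rewrite fB; exists 1%N, (fun=> 1), (fun=> x).
  by rewrite !big_ord1 scale1r.
have sumM k (c : 'I_k -> R) a : \sum_i c i = 1 ->
    (forall i, (a i - b <= M)%MS) -> (\sum_i c i *: a i - b <= M)%MS.
  move=> c1 aM; rewrite -[b]scale1r -c1 scaler_suml -sumrB.
  by apply: summx_sub => i _; rewrite -scalerBr scalemx_sub.
(* [sumM] is applied twice: to the affine combination, then to the convex combinations that are its
   points. *)
have fullM y : (y - b <= M)%MS.
  have : affine_hull (convex_hull (B `|` range v)) y by rewrite CT.
  move=> [k [c [a [c1 aC ->]]]]; apply: (sumM) => // i.
  have [h [c' [a' [_ c'1 a'B ->]]]] := aC i; apply: sumM => // l.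
  have [/BA [z ->]|[j _ <-]] := a'B l.
    by rewrite addrK (submx_trans (submxMl _ _)) // -addsmxE addsmxSl.
  have -> : v j - b = row j W by rewrite rowK.
  by rewrite (submx_trans (row_sub _ _)) // -addsmxE addsmxSr.
have Mu : M \in unitmx.
  rewrite -row_full_unit -sub1mx; apply/row_subP => i.
  by rewrite -[row i _](addrK b).
pose phi j : {scalar 'rV[R]_(n + m)} := coordinate_form (invmx M) (rshift n j).
have phiM x y j : phi j (row_mx x y *m M + b) = y 0 j + phi j b.
  by rewrite linearD /= {1}/coordinate_form mulmxK // row_mxEr.
exists phi, (fun j => phi j b); split=> [j x /BA [z ->]|i j].
  have -> : z *m A = row_mx z 0 *m M by rewrite mul_row_col mul0mx addr0.
  by rewrite phiM mxE add0r.
have -> : v i = row_mx 0 (delta_mx 0 i) *m M + b.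
  by rewrite mul_row_col mul0mx add0r -rowE rowK subrK.
by rewrite phiM mxE eqxx /= addrC eq_sym.
Qed.

Theorem theorem1p4 (R : realType) (n m : nat) (B : set 'rV[R]_(n + m))
    (v : 'I_m -> 'rV[R]_(n + m))
    (D : set 'rV[R]_n) (D' : set 'rV[R]_(n + m)) :
  (1 <= n)%N -> (1 <= m)%N ->
  is_simplex D -> is_simplex D' ->
  convex_body_dim n B ->
  (banach_mazur_dim n B D <= 2%:E)%E ->
  convex_body_dim (n + m) (convex_hull (B `|` range v)) ->
  banach_mazur (convex_hull (B `|` range v)) D' = banach_mazur_dim n B D.
Proof.
case: m => // m in B v D' *.
move=> n_gt0 _ Ds D's [_ Bconv Bdim] + [_ Cconv Cdim].
have [f fB] := affine_iso_exists Bdim.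
have CT := affine_dim_full Cdim.
have [phi [e [phiB phiv]]] := apex_forms fB CT.
set C := convex_hull _ in Cconv CT *.
have BS : B `<=` affine_hull B.
  move=> x Bx; exists 1%N, (fun=> 1), (fun=> x).
  by rewrite !big_ord1 scale1r.
(* The affine hull contains [f 0], and the weights of an empty combination cannot sum to 1. *)
have B0 : B !=set0.
  have [A [b [_ _ fS]]] := fB.
  have [k [c [a [c1 aB _]]]] : affine_hull B (f 0) by rewrite -fS; exists 0.
  case: k => [|k] in c a c1 aB *; last by exists (a ord0).
  by move: c1; rewrite big_ord0 => /eqP; rewrite eq_sym oner_eq0.
have idD : affine_iso id (affine_hull D).
  rewrite simplex_affine_hull //; exists 1%:M, 0; split.
  - by rewrite row_free_unit unitmx1.
  - by apply/funext => x; rewrite mulmx1 addr0.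
  - by apply/seteqP; split=> // x _; exists x.
rewrite (banach_mazur_dimE fB idD) preimage_id.
have Bconv' := affine_iso_convex fB Bconv.
(* [inord] extends the family to [nat]; it needs an index type of the form ['I_m.+1], hence the
   initial case on [m]. *)
pose v' k := v (inord k).
have CE : C = cone_tower B v' m.+1.
  have vE : range v = [set v' i | i in [set i | (i < m.+1)%N]].
    apply/seteqP; split=> _ [i im <-]; last by exists (inord i).
    by exists (i : nat) => //=; rewrite /v' inord_val.
  by rewrite cone_tower_hull // -vE.
have phiB' j x : (j < m.+1)%N -> B x -> phi (inord j) x = e (inord j).
  by move=> _; apply: phiB.
have phiv' i j : (i < m.+1)%N -> (j < m.+1)%N ->
    phi (inord j) (v' i) = e (inord j) + (i == j)%:R.
  by move=> im jm; rewrite phiv -val_eqE /= !inordK.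
have nm_gt0 : (0 < n + m.+1)%N by rewrite addnS.
move=> le2; apply/eqP; rewrite eq_le; apply/andP; split.
  apply: le_ereal_inf_tmp => _ [rho rhoP <-].
  apply: ereal_inf_lbound; exists rho => //.
  apply: sandwich_bm_ratio => //.
  rewrite CE; apply: (simplex_sandwich_tower phiB' phiv') => //.
  apply/(simplex_sandwich_affine_iso fB BS).
  exact: bm_ratio_sandwich rhoP.
apply: le_ereal_inf_tmp => _ [rho rhoP <-].
(* A ratio above 2 for [C] exceeds the distance of [B] by hypothesis; the others descend the
   tower. *)
have [rho2|rho2] := lerP rho 2; last first.
  by apply: le_trans le2 _; rewrite lee_fin ltW.
apply: ereal_inf_lbound; exists rho => //.
apply: sandwich_bm_ratio => //.
apply/(simplex_sandwich_affine_iso fB BS).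
apply: (simplex_sandwich_tower_inv phiB' phiv' (leqnn _) rho2).
by rewrite -CE; apply: bm_ratio_sandwich rhoP.
Qed.
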